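(* For every $n\ge 4$, the $(1,3)$-biased Clique game on $K_n$ is won by player $2$.
   Context: Two players, Alice (player 1, starting) and Bob (player 2), alternately colour uncoloured edges of the complete graph $K_n$, Alice in red and Bob in blue. In the $(p,q)$-biased version Alice colours $p$ edges on each of her turns and Bob colours $q$ edges on each of his turns. In the Clique game, at the end Alice's score is $a=\omega(G[A])$ and Bob's score is $b=\omega(G[B])$, the clique numbers of the graphs formed by the red edges $A$ and the blue edges $B$. When $q>p$, Bob (player 2) wins if at the end $b>a$. Here $(p,q)=(1,3)$. *)

(* Defs.v *)
From mathcomp Require Import all_boot.

Set Implicit Arguments.
Unset Strict Implicit.
Unset Printing Implicit Defensive.

Section CliqueGame.

Variable n : nat.

(* A graph on the vertex set 'I_n is given by its edge set. *)
Definition edge_set := {set {set 'I_n}}.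

Definition complete_edges : edge_set := [set e : {set 'I_n} | #|e| == 2].

Definition is_clique (E : edge_set) (S : {set 'I_n}) : bool :=
  [forall x in S, forall y in S, (x != y) ==> ([set x; y] \in E)].

Definition clique_number (E : edge_set) : nat :=
  \max_(S : {set 'I_n} | is_clique E S) #|S|.

(* A history lists the sets of edges coloured in the successive turns, oldest  *)
(* first.  Turns are numbered from 0, so player 1 (red) plays the even turns   *)
(* and player 2 (blue) the odd ones.                                           *)
Definition history := seq edge_set.

Definition red (h : history) : edge_set :=
  \bigcup_(i < size h | ~~ odd i) nth set0 h i.

Definition blue (h : history) : edge_set :=
  \bigcup_(i < size h | odd i) nth set0 h i.

Definition uncoloured (h : history) : edge_set :=
  complete_edges :\: (red h :|: blue h).

Definition finished (h : history) : bool := uncoloured h == set0.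

Definition player2_to_move (h : history) : bool := odd (size h).

Variables p q : nat.

(* The last turn of the game may be a short one: a player facing fewer         *)
(* uncoloured edges than the bias requires colours all of them.                *)
Definition legal_turn (h : history) (t : edge_set) : bool :=
  [&& ~~ finished h,
      t \subset uncoloured h
    & #|t| == minn (if player2_to_move h then q else p) #|uncoloured h|].

Definition legal_history (h : history) : Prop :=
  forall i, i < size h -> legal_turn (take i h) (nth set0 h i).

(* A strategy prescribes the next turn from the whole history; its values      *)
(* matter only on unfinished histories in which its owner is to move.          *)
Definition strategy := history -> edge_set.

Definition follows2 (sigma : strategy) (h : history) : Prop :=
  forall i, i < size h -> odd i -> nth set0 h i = sigma (take i h).

(* The winning condition b > a of player 2 is the one used when q > p. *)
Definition winning_strategy2 (sigma : strategy) : Prop :=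
  forall h : history, legal_history h -> follows2 sigma h ->
    (~~ finished h -> player2_to_move h -> legal_turn h (sigma h)) /\
    (finished h -> clique_number (red h) < clique_number (blue h)).

Definition clique_game_won_by_player2 : Prop :=
  exists sigma : strategy, winning_strategy2 sigma.

End CliqueGame.

(* Main.v *)
Require Import Defs.
From mathcomp Require Import all_boot.
From mathcomp Require Import boolp.

Set Implicit Arguments.
Unset Strict Implicit.
Unset Printing Implicit Defensive.

(** After Alice's first edge uv, Bob chooses vertices e, c and (if n is odd) o
    off that edge, claims the clique they form, and pairs up all the other
    vertices by an involution x |-> x', with u' = v.  From then on he answers
      - xy, with x and y in different pairs, by x'y', xy' and x'y;
      - xx' by ex and ex';
      - ex by ex', cx' and xx';   cx by cx', ex' and ox';   ox by ox' and cx';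
    except that for the pair uv nothing is owed for xx', nor xx' after ex.
    Being an answer to is a symmetric relation, so every answer is available.

    At the end let S be a red clique.  If S contains a pair x, x', it has no
    other vertex, and ecx or ecx' is a blue triangle.  Else S contains at most
    one of e, c, o and at most one vertex of each pair, and T', the mirror image
    of T = S minus {e, c, o}, is a blue clique.  If g in {e, c, o} lies in S, then
    T' + g + c is a blue clique (T' + c + e if g = c).  Otherwise S = T; if some
    xx' with x in S is blue, T' + x is a blue clique.  If all these edges are
    red, then e is joined in blue to T', except possibly to v', with v in the
    first pair, in which case (T - v)' + v + e is a blue clique. *)

(** * Frames, owed answers and the invariant *)

(* [mate] fixes exactly [hub] = e, [mid] = c and [odd_one] = o; when n is even,
   [odd_one] is taken equal to [mid].  [exempt] is an end of Alice's first edge. *)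
Record frame (n : nat) := Frame {
  hub : 'I_n;
  mid : 'I_n;
  odd_one : 'I_n;
  exempt : 'I_n;
  mate : 'I_n -> 'I_n;
  mateK : involutive mate;
  mate_fix : forall x, (mate x == x) = (x \in [:: hub; mid; odd_one]);
  hub_mid : hub != mid;
  hub_odd_one : hub != odd_one }.

Definition is_exempt n (F : frame n) (x : 'I_n) :=
  (x == exempt F) || (x == mate F (exempt F)).

(** The order of the arguments matters: an edge with one special end (fixed by [mate]) has its
    answers listed only when that end comes first. An edge between two special vertices owes
    nothing. *)
Definition answer n (F : frame n) (x y : 'I_n) : seq {set 'I_n} :=
  let: (e, c, o, t) := (hub F, mid F, odd_one F, mate F) in
  if t y == y then [::] else
  if t x != x then
    if y == t x then
      if is_exempt F x then [::] else [:: [set e; x]; [set e; t x]]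
    else [:: [set t x; t y]; [set x; t y]; [set t x; y]]
  else if x == c then [:: [set c; t y]; [set e; t y]; [set o; t y]]
  else if x == e then
    [:: [set e; t y], [set c; t y] &
        if is_exempt F y then [::] else [:: [set y; t y]]]
  else [:: [set o; t y]; [set c; t y]].

(** The last three clauses make the special vertices a blue clique. The final one is conditional
    because, when [odd_one] is [mid], the set in it is a singleton and not an edge. *)
Definition safe_for n (F : frame n) (R B : edge_set n) :=
  [/\ [disjoint R & B],
      forall x y, [set x; y] \in R -> {subset answer F x y <= B},
      [set hub F; mid F] \in B, [set hub F; odd_one F] \in B
    & odd_one F != mid F -> [set odd_one F; mid F] \in B].

Definition safe n (R B : edge_set n) := exists F : frame n, safe_for F R B.

Lemma set2_eq (T : finType) (x y p q : T) : [set x; y] = [set p; q] ->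
  (x = p /\ y = q) \/ (x = q /\ y = p).
Proof.
move=> E.
have := set21 x y; rewrite E !inE => /orP[] /eqP Ex;
have := set22 x y; rewrite E !inE => /orP[] /eqP Ey; subst; auto.
  by have := set22 p q; rewrite -E !inE orbb => /eqP ->; left.
by have := set21 p q; rewrite -E !inE orbb => /eqP ->; left.
Qed.

Lemma mate_eq n (F : frame n) x y : (mate F x == y) = (x == mate F y).
Proof. by rewrite -(inj_eq (can_inj (mateK F)) x) mateK. Qed.

Lemma is_exempt_mate n (F : frame n) x : is_exempt F (mate F x) = is_exempt F x.
Proof. by rewrite /is_exempt !mate_eq mateK orbC. Qed.

Lemma mate_hub n (F : frame n) : mate F (hub F) = hub F.
Proof. by apply/eqP; rewrite mate_fix !inE eqxx. Qed.

Lemma mate_mid n (F : frame n) : mate F (mid F) = mid F.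
Proof. by apply/eqP; rewrite mate_fix !inE eqxx !orbT. Qed.

Lemma mate_odd_one n (F : frame n) : mate F (odd_one F) = odd_one F.
Proof. by apply/eqP; rewrite mate_fix !inE eqxx !orbT. Qed.


Lemma size_answer n (F : frame n) x y : size (answer F x y) <= 3.
Proof. by rewrite /answer; do !case: ifP. Qed.

(** * Symmetry of the answer relation *)

Section Answers.
Context (n : nat) (F : frame n).
Implicit Types x y : 'I_n.

Definition outside x := mate F x != x.

Lemma outside_mate x : outside (mate F x) = outside x.
Proof. by rewrite /outside mateK eq_sym. Qed.

Lemma answer_inside x y : ~~ outside y -> answer F x y = [::].
Proof. by rewrite /answer /outside negbK => ->. Qed.

Lemma answer_mate x : outside x ->
  answer F x (mate F x) =
    if is_exempt F x then [::] else [:: [set hub F; x]; [set hub F; mate F x]].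
Proof.
move=> ox; have oy : outside (mate F x) by rewrite outside_mate.
by rewrite /answer (negPf oy) (negPf ox) eqxx.
Qed.

Lemma answer_cross x y : outside x -> outside y -> y != mate F x ->
  answer F x y = [:: [set mate F x; mate F y]; [set x; mate F y]; [set mate F x; y]].
Proof. by move=> ox oy nyx; rewrite /answer (negPf oy) (negPf ox) (negPf nyx). Qed.

Lemma answer_mid y : outside y ->
  answer F (mid F) y =
    [:: [set mid F; mate F y]; [set hub F; mate F y]; [set odd_one F; mate F y]].
Proof. by move=> oy; rewrite /answer (negPf oy) mate_mid !eqxx. Qed.

Lemma answer_hub y : outside y ->
  answer F (hub F) y =
    [:: [set hub F; mate F y], [set mid F; mate F y] &
        if is_exempt F y then [::] else [:: [set y; mate F y]]].
Proof.
by move=> oy; rewrite /answer (negPf oy) mate_hub !eqxx (negPf (hub_mid F)).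
Qed.

Lemma answer_odd_one y : outside y -> odd_one F != mid F ->
  answer F (odd_one F) y =
    [:: [set odd_one F; mate F y]; [set mid F; mate F y]].
Proof.
move=> oy oc; rewrite /answer (negPf oy) mate_odd_one !eqxx (negPf oc).
by rewrite (eq_sym _ (hub F)) (negPf (hub_odd_one F)).
Qed.

Variant inside_spec x : Prop :=
  | InsideMid of x = mid F
  | InsideHub of x = hub F
  | InsideOdd of x = odd_one F & odd_one F != mid F.

Lemma insideP x : ~~ outside x -> inside_spec x.
Proof.
rewrite /outside negbK mate_fix !inE.
case: (eqVneq x (mid F)) => [|xc]; first by move=> ? _; apply: InsideMid.
case: (eqVneq x (hub F)) => [|xe]; first by move=> ? _; apply: InsideHub.
by move=> /= /eqP xo; apply: InsideOdd; rewrite -?xo.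
Qed.

(** Exchanging the ends only permutes the answers, and exemption belongs to a pair, not to one of
    its ends. *)
Lemma answer_swap x y : outside x -> outside y -> answer F x y =i answer F y x.
Proof.
move=> ox oy; case: (eqVneq y (mate F x)) => [-> z|nyx z].
  have := @answer_mate (mate F x); rewrite outside_mate mateK is_exempt_mate.
  by move=> /(_ ox) ->; rewrite answer_mate //; case: ifP => // _; rewrite !inE orbC.
have nxy : x != mate F y by rewrite -mate_eq eq_sym.
rewrite (answer_cross ox oy nyx) (answer_cross oy ox nxy).
rewrite (setUC [set mate F y]) (setUC [set y]) (setUC [set mate F y]) !inE.
by congr (_ || _); rewrite orbC.
Qed.

(* Hence an edge that Bob must answer with is never red: it would have forced
   Alice's edge to be blue already. *)
Lemma answer_sym x y z : x != y -> z \in answer F x y ->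
  exists x' y', z = [set x'; y'] /\ [set x; y] \in answer F x' y'.
Proof.
move=> nxy.
have [oy|/answer_inside-> //] := boolP (outside y).
have oy' : outside (mate F y) by rewrite outside_mate.
have [ox|/insideP[->|->|-> oc]] := boolP (outside x).
- have ox' : outside (mate F x) by rewrite outside_mate.
  have [->|nyx] := eqVneq y (mate F x).
    rewrite answer_mate //; case: ifP => // nex; rewrite !inE => /orP[]/eqP->.
      by exists (hub F), x; rewrite answer_hub // nex !inE eqxx !orbT.
    exists (hub F), (mate F x).
    by rewrite answer_hub // is_exempt_mate nex mateK (setUC [set x]) !inE eqxx !orbT.
  rewrite answer_cross // !inE => /or3P[]/eqP->; eexists _, _; split=> //.
  + by rewrite answer_cross ?mateK ?mate_eq // !inE eqxx.
  + by rewrite answer_cross ?mateK ?(inj_eq (can_inj (mateK F))) 1?eq_sym // !inE eqxx orbT.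
  + by rewrite answer_cross ?mateK 1?eq_sym // !inE eqxx !orbT.
- rewrite answer_mid // !inE => /or3P[]/eqP->.
  + by exists (mid F), (mate F y); rewrite answer_mid // mateK !inE eqxx.
  + by exists (hub F), (mate F y); rewrite answer_hub // mateK !inE eqxx orbT.
  + exists (odd_one F), (mate F y); split=> //.
    (* When [odd_one] coincides with [mid], [answer] uses the longer list of [mid]. *)
    have [->|oc] := eqVneq (odd_one F) (mid F).
      by rewrite answer_mid // mateK !inE eqxx.
    by rewrite answer_odd_one // mateK !inE eqxx orbT.
- rewrite answer_hub // !inE => /or3P[/eqP->|/eqP->|].
  + by exists (hub F), (mate F y); rewrite answer_hub // mateK !inE eqxx.
  + by exists (mid F), (mate F y); rewrite answer_mid // mateK !inE eqxx orbT.
  + case: ifP => // nex; rewrite inE => /eqP->.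
    by exists y, (mate F y); rewrite answer_mate // nex !inE eqxx.
- rewrite answer_odd_one // !inE => /orP[]/eqP->.
  + by exists (odd_one F), (mate F y); rewrite answer_odd_one // mateK !inE eqxx.
  + by exists (mid F), (mate F y); rewrite answer_mid // mateK !inE eqxx !orbT.
Qed.

(** Every answer contains the mirror image of an end of xy, and that image is off xy. The exception
    is a pair edge xx', whose answers contain the hub instead. *)
Lemma answer_irr x y : x != y -> [set x; y] \notin answer F x y.
Proof.
move=> nxy; apply/negP.
have [oy|/answer_inside-> //] := boolP (outside y).
have miss g w z : ~~ outside g -> outside w ->
    [set g; w] = z -> mate F w \in z -> False.
  move=> ig ow <-; rewrite !inE (negPf ow) orbF => /eqP ew.
  by rewrite -ew outside_mate ow in ig.
have [ox|ix] := boolP (outside x).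
  have [->|nyx] := eqVneq y (mate F x).
    rewrite answer_mate //; case: ifP => // _.
    rewrite !inE => /orP[]/eqP/esym E; apply: (miss _ _ _ _ _ E).
    - by rewrite /outside mate_hub eqxx.
    - by [].
    - by rewrite !inE eqxx orbT.
    - by rewrite /outside mate_hub eqxx.
    - by rewrite outside_mate.
    - by rewrite mateK !inE eqxx.
  rewrite answer_cross // !inE => /or3P[]/eqP E.
  - have := set21 (mate F x) (mate F y).
    by rewrite -E !inE (negPf ox) eq_sym (negPf nyx).
  - have := set22 x (mate F y).
    by rewrite -E !inE (negPf oy) mate_eq (negPf nyx).
  - have := set21 (mate F x) y.
    by rewrite -E !inE (negPf ox) eq_sym (negPf nyx).
have bad g : [set x; y] <> [set g; mate F y].
  by move=> E; apply: (miss _ _ _ ix oy E); rewrite !inE eqxx orbT.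
have [e|e|e oc] := insideP ix; move: (bad); rewrite e => bad'.
- by rewrite answer_mid // !inE => /or3P[]/eqP/bad'.
- rewrite answer_hub // !inE => /or3P[/eqP/bad'|/eqP/bad'|] //.
  by case: ifP => // _; rewrite inE => /eqP/bad'.
- by rewrite answer_odd_one // !inE => /orP[]/eqP/bad'.
Qed.

Lemma answer_edge x y z : x != y -> z \in answer F x y ->
  z \in complete_edges n.
Proof.
move=> nxy; rewrite /complete_edges [z \in [set _ | _]]inE.
have [oy|/answer_inside-> //] := boolP (outside y).
have neq g w : ~~ outside g -> outside w -> #|[set g; w]| == 2.
  move=> ig ow; rewrite cards2; case: (g =P w) => // eg.
  by rewrite eg ow in ig.
have oy' : outside (mate F y) by rewrite outside_mate.
have ic : ~~ outside (mid F) by rewrite /outside mate_mid eqxx.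
have ie : ~~ outside (hub F) by rewrite /outside mate_hub eqxx.
have io : ~~ outside (odd_one F) by rewrite /outside mate_odd_one eqxx.
have [ox|/insideP[->|->|-> oc]] := boolP (outside x).
- have ox' : outside (mate F x) by rewrite outside_mate.
  have [->|nyx] := eqVneq y (mate F x).
    rewrite answer_mate //; case: ifP => // nex; rewrite !inE.
    by case/orP=> /eqP->; apply: neq.
  rewrite answer_cross // !inE => /or3P[]/eqP->; rewrite cards2.
  + by rewrite (inj_eq (can_inj (mateK F))) nxy.
  + by rewrite -mate_eq (eq_sym _ y) nyx.
  + by rewrite (eq_sym _ y) nyx.
- by rewrite answer_mid // !inE => /or3P[]/eqP->; apply: neq.
- rewrite answer_hub // !inE => /or3P[/eqP->|/eqP->|]; try exact: neq.
  case: ifP => // nex; rewrite inE => /eqP->.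
  by rewrite cards2 (eq_sym y) (negPf oy).
- by rewrite answer_odd_one // !inE => /orP[]/eqP->; apply: neq.
Qed.

(** The invariant speaks of both orders of the ends of a red edge. One list serves both: either the
    two lists agree, or one of them is empty. So three edges are enough. *)
Lemma answer_covers p q : exists2 K : seq {set 'I_n},
  K = answer F p q \/ K = answer F q p &
  {subset answer F p q <= K} /\ {subset answer F q p <= K}.
Proof.
have [op|ip] := boolP (outside p); last first.
  by exists (answer F p q); [left | split=> // z; rewrite (answer_inside _ ip)].
have [oq|iq] := boolP (outside q); last first.
  by exists (answer F q p); [right | split=> // z; rewrite (answer_inside _ iq)].
by exists (answer F p q); [left | split=> // z; rewrite answer_swap].
Qed.

End Answers.

(** * Answering one red edge *)

(** Allowing every [B'] above [B] and [K] leaves Bob free to spend on arbitrary edges whatever part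
    of his turn [K] does not use up. *)
Definition answerable n (R B : edge_set n) (a : {set 'I_n}) :=
  exists2 K : seq {set 'I_n},
    size K <= 3 /\ {in K, forall z, (z \in complete_edges n) && (z \notin a |: R)}
  & forall B' : edge_set n, B \subset B' -> {subset K <= B'} -> [disjoint a |: R & B'] ->
    safe (a |: R) B'.

Lemma complete_edgesP n (a : {set 'I_n}) :
  reflect (exists p q, p != q /\ a = [set p; q]) (a \in complete_edges n).
Proof. by rewrite inE; apply: cards2P. Qed.

Lemma safe_answerable n (R B : edge_set n) a :
  safe R B -> a \in complete_edges n -> a \notin R -> a \notin B ->
  answerable R B a.
Proof.
move=> [F [dRB ans ec eo oc]] /complete_edgesP[p [q [npq ea]]] aR aB.
have nqp : q != p by rewrite eq_sym.
have [K eK [Kpq Kqp]] := answer_covers F p q.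
exists K; first split.
- by case: eK => ->; apply: size_answer.
- move=> z zK; have : z \in answer F p q \/ z \in answer F q p.
    by case: eK => <-; auto.
  have key x y : x != y -> a = [set x; y] -> z \in answer F x y ->
      (z \in complete_edges n) && (z \notin a |: R).
    move=> nxy ea' zxy; rewrite (answer_edge nxy zxy) /=.
    have [x' [y' [ez]]] := answer_sym nxy zxy; rewrite -ea' => aans.
    rewrite inE inE negb_or; apply/andP; split.
      by apply: contraTneq zxy => ->; rewrite ea' answer_irr.
    by apply: contra aB; rewrite ez => /ans; apply.
  by case; apply: key; rewrite // setUC.
- move=> B' sB sK dis; exists F; split=> //; try exact: (subsetP sB).
    move=> x y; rewrite inE inE => /orP[/eqP|/ans sub z /sub]; last exact: (subsetP sB).
    by rewrite ea => /set2_eq[][-> ->] z zK; apply: sK; auto.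
  by move=> noc; apply: (subsetP sB); apply: oc.
Qed.

(** * Matchings and the choice of a frame *)

Lemma extend_matching (T : eqType) (u v : T) (l : seq T) (t : T -> T) :
  involutive t -> (forall x, (t x == x) = (x \notin l)) -> uniq [:: u, v & l] ->
  exists t', [/\ involutive t', forall x, (t' x == x) = (x \notin [:: u, v & l])
    & t' u = v].
Proof.
move=> tK tfix; rewrite /= inE negb_or -andbA => /and4P[nuv ul vl _].
have tu : t u = u by apply/eqP; rewrite tfix.
have tv : t v = v by apply/eqP; rewrite tfix.
have te x w : t w = w -> (t x == w) = (x == w).
  by move=> tw; rewrite -{1}tw (inj_eq (can_inj tK)).
exists (fun x => if x == u then v else if x == v then u else t x); split.
- move=> x; have [->|xu] := eqVneq x u; first by rewrite eqxx eq_sym (negPf nuv).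
  have [->|xv] := eqVneq x v; first by rewrite eqxx.
  by rewrite !te // (negPf xu) (negPf xv).
- move=> x; rewrite !inE; have [->|xu] := eqVneq x u.
    by rewrite eq_sym (negPf nuv).
  by have [->|xv] := eqVneq x v; rewrite ?(negPf nuv) // tfix.
- by rewrite eqxx.
Qed.

Lemma matching_exists (T : eqType) (l : seq T) : uniq l -> ~~ odd (size l) ->
  exists t, involutive t /\ forall x : T, (t x == x) = (x \notin l).
Proof.
have [k] := ubnP (size l); elim: k l => // k IH [|u [|v l]] //= sl ul ol.
  by exists id; split=> // x; rewrite eqxx.
have sl' : size l < k by rewrite ltnW.
have ul' : uniq l by case/and3P: ul.
have ol' : ~~ odd (size l) by rewrite negbK in ol.
have [t [tK tfix]] := IH l sl' ul' ol'.
have [t' [tK' tfix' _]] := extend_matching tK tfix ul.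
by exists t'.
Qed.

Lemma frame_exists n (u v : 'I_n) : 4 <= n -> u != v -> exists F : frame n,
  [/\ exempt F = u, mate F u = v, outside F u & outside F v].
Proof.
move=> n4 nuv; have [L uL [mL sL]] : exists2 L : seq 'I_n, uniq L &
    (forall x, (x \in L) = (x \notin [:: u; v])) /\ size L = n - 2.
  exists (enum [predC [:: u; v]]); first exact: enum_uniq.
  split=> [x|]; first by rewrite mem_enum !inE.
  have /(congr1 (subn^~ 2)) := cardC [in [:: u; v]].
  have -> : #|[in [:: u; v]]| = 2.
    by apply/eqP; rewrite (card_uniqP _) //= inE nuv.
  by rewrite addKn card_ord -cardE => <-; apply: eq_card => x; rewrite !inE.
have build e c o l : uniq l -> ~~ odd (size l) ->
    e != c -> e != o ->
    (forall x, (x \notin [:: u, v & l]) = (x \in [:: e; c; o])) ->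
    u \notin l -> v \notin l -> 
    exists F : frame n, [/\ exempt F = u, mate F u = v, outside F u & outside F v].
  move=> ul ol ec eo part ul' vl'.
  have [t0 [tK0 fix0]] := matching_exists ul ol.
  have [|t [tK tfix tu]] := @extend_matching _ u v l t0 tK0 fix0.
    by rewrite /= inE negb_or nuv ul' vl'.
  have tfix' x : (t x == x) = (x \in [:: e; c; o]) by rewrite tfix part.
  have tv : t v = u by rewrite -tu tK.
  exists (Frame u tK tfix' ec eo); rewrite /outside /= tu tv.
  by split; rewrite // eq_sym.
have fix_part G l : uniq (G ++ l) -> (forall x, (x \in G ++ l) = (x \notin [:: u; v])) ->
    [/\ forall x, (x \notin [:: u, v & l]) = (x \in G), u \notin l & v \notin l].
  rewrite cat_uniq => /and3P[_ /hasPn dis _] mG; split.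
  - move=> x; have := mG x; have := dis x; rewrite mem_cat !inE !negb_or.
    case: (x \in l) => /= [/(_ isT)/negPf-> _|_]; first by rewrite !andbF.
    by rewrite orbF andbT => ->.
  - by have := mG u; rewrite mem_cat !inE eqxx /= => /norP[].
  - by have := mG v; rewrite mem_cat !inE eqxx orbT /= => /norP[].
(* Since n is at least 4, at least two vertices lie off uv, which provides e and c. *)
have n2 : n - 2 = (n - 4).+2 by rewrite -subSn // -subSn // leqW.
rewrite n2 in sL.
case: L uL mL sL => [|e [|c l]] //= uL mL [sl].
(* Two vertices become special if n is even and three if n is odd, so that an even number is left to
   be matched. *)
case od : (odd n); last first.
  have [part ul vl] := fix_part [:: e; c] l uL mL.
  case/and3P: uL; rewrite inE negb_or => /andP[ec _] _ ul'.
  apply: (build e c c l) => //.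
    by rewrite sl oddB // od.
  by move=> x; rewrite part !inE orbb.
(* Here n - 4 is odd, hence positive, and a third special vertex exists. *)
case: l uL mL sl => [|o l] //= uL mL sl.
  by move: (oddB n4); rewrite -sl od.
have [part ul vl] := fix_part [:: e; c; o] l uL mL.
case/and4P: uL; rewrite !inE !negb_or => /and3P[ec eo _] _ _ ul'.
apply: (build e c o l) => //.
have : odd (size l).+1 by rewrite sl oddB // od.
by [].
Qed.

(** Alice's first edge is made the exempt pair, so it owes no answer, and Bob's whole turn can go
    into the clique on the special vertices, which has at most three edges. *)
Lemma opening_answerable n (a : {set 'I_n}) :
  4 <= n -> a \in complete_edges n -> answerable set0 set0 a.
Proof.
move=> n4 /complete_edgesP[u [v [nuv ->]]].
have [F [eu mu ou ov]] := frame_exists n4 nuv.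
have inF x : ~~ outside F x -> x \notin [set u; v].
  by apply: contra; rewrite !inE => /orP[]/eqP->.
have ie : ~~ outside F (hub F) by rewrite /outside mate_hub eqxx.
have io : ~~ outside F (odd_one F) by rewrite /outside mate_odd_one eqxx.
have Kok x y : x != y -> ~~ outside F x ->
    ([set x; y] \in complete_edges n) && ([set x; y] \notin [set u; v] |: set0).
  move=> nxy ix; rewrite inE cards2 nxy !inE orbF eqxx /=.
  by apply: contraNneq (inF x ix) => <-; rewrite !inE eqxx.
exists [:: [set hub F; mid F], [set hub F; odd_one F] &
        if odd_one F == mid F then [::] else [:: [set odd_one F; mid F]]].
  split; first by case: ifP.
  move=> z; rewrite !in_cons => /or3P[/eqP->|/eqP->|].
  - exact: Kok (hub_mid F) ie.
  - exact: Kok (hub_odd_one F) ie.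
  - by case: eqP => // /eqP oc; rewrite mem_seq1 => /eqP->; apply: Kok.
move=> B' _ sK dis; exists F; split=> //.
- move=> x y; rewrite !inE orbF => /eqP/set2_eq[][-> ->] z.
    by have := answer_mate ou; rewrite /is_exempt eu mu eqxx => ->.
  have mv : mate F v = u by rewrite -mu mateK.
  by have := answer_mate ov; rewrite /is_exempt mv eu mu eqxx orbT => ->.
- by apply: sK; rewrite !inE eqxx.
- by apply: sK; rewrite !inE eqxx orbT.
- by move=> /negPf oc; apply: sK; rewrite oc !inE eqxx !orbT.
Qed.

(** * Comparing cliques in the final position *)

Lemma cliqueP n (E : edge_set n) (S : {set 'I_n}) :
  reflect {in S &, forall x y, x != y -> [set x; y] \in E} (is_clique E S).
Proof.
apply: (iffP forall_inP) => [cl x y xS yS nxy|cl x xS].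
  by have /forall_inP/(_ y yS)/implyP := cl x xS; apply.
by apply/forall_inP => y yS; apply/implyP; apply: cl.
Qed.

Lemma is_cliqueU1 n (E : edge_set n) (S : {set 'I_n}) z :
  is_clique E S -> {in S, forall x, [set z; x] \in E} -> is_clique E (z |: S).
Proof.
move=> /cliqueP cl zS; apply/cliqueP => x y.
rewrite !inE => /orP[/eqP->|xS] /orP[/eqP->|yS]; rewrite ?eqxx //.
- by move=> _; apply: zS.
- by move=> _; rewrite setUC; apply: zS.
- exact: cl.
Qed.

Lemma clique_number_lt n (R B : edge_set n) :
  (forall S, is_clique R S -> exists2 S', is_clique B S' & #|S| < #|S'|) ->
  clique_number R < clique_number B.
Proof.
move=> better; rewrite /clique_number.
have [|S cS ->] := @eq_bigmax_cond _ [pred S | is_clique R S] (fun S : {set 'I_n} => #|S|).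
  (* The empty clique guarantees that the maximum is attained. *)
  by apply/card_gt0P; exists set0; rewrite inE; apply/cliqueP => x y; rewrite inE.
have [S' cS' lt] := better S cS.
apply: leq_trans lt _.
exact: (@leq_bigmax_cond _ (is_clique B) (fun S : {set 'I_n} => #|S|)).
Qed.

Lemma safe_wins n (R B : edge_set n) :
  safe R B -> (forall x y, x != y -> ([set x; y] \in R) || ([set x; y] \in B)) ->
  clique_number R < clique_number B.
Proof.
move=> [F [dRB ans Bec Beo Boc]] full; apply: clique_number_lt => S /cliqueP clS.
have notRB z : z \in R -> z \in B -> False.
  by move=> zR zB; have /pred0P/(_ z) := dRB; rewrite /= zR zB.
have neq g w : ~~ outside F g -> outside F w -> g != w.
  by move=> ig ow; apply: contraNneq ig => ->.
have ie : ~~ outside F (hub F) by rewrite /outside mate_hub eqxx.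
have ic : ~~ outside F (mid F) by rewrite /outside mate_mid eqxx.
have far x y : outside F x -> outside F y -> x != y -> y != mate F x ->
    [set x; y] \in R ->
    [set mate F x; mate F y] \in B /\ [set x; mate F y] \in B.
  move=> ox oy nxy nyx /ans sub; split; apply: sub;
    by rewrite answer_cross // !inE eqxx ?orbT.
have near g w : ~~ outside F g -> outside F w -> [set g; w] \in R ->
    [/\ [set g; mate F w] \in B, [set mid F; mate F w] \in B &
     g = mid F -> [set hub F; mate F w] \in B].
  move=> /insideP[->|->|-> oc] ow /ans sub; split=> [||E];
    try by apply: sub; rewrite ?answer_mid ?answer_hub ?answer_odd_one // !inE eqxx ?orbT.
  by rewrite E eqxx in oc.
have BG g h : ~~ outside F g -> ~~ outside F h -> g != h -> [set g; h] \in B.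
  move=> /insideP[->|->|-> oc] /insideP[->|->|-> oc']; rewrite ?eqxx // => _;
    by rewrite 1?setUC // ?Boc // setUC ?Boc.
have [/existsP[x /and3P[xS txS ox]]|no_pair] :=
  boolP [exists x, [&& x \in S, mate F x \in S & outside F x]].
  have nx : x != mate F x by rewrite eq_sym.
  (* For a further vertex y of S, the answers to the red edge xy include yx', which is red as
     well. *)
  have subS : S \subset [set x; mate F x].
    apply/subsetP => y yS; rewrite !inE; apply: contraT; rewrite negb_or => /andP[yx ytx].
    have ytx' : [set y; mate F x] \in R by apply: clS.
    have yx' : [set y; x] \in R by apply: clS.
    have [oy|iy] := boolP (outside F y).
      have xty : x != mate F y by rewrite -mate_eq eq_sym.
      have [_ b] := far y x oy ox yx xty yx'.
      by case: (notRB _ ytx' b).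
    have [b _ _] := near y x iy ox yx'.
    by case: (notRB _ ytx' b).
  (* If ex or cx is red, its answers include both ex' and cx', so z is x'. Otherwise z is x. *)
  have [z nz [ez cz]] : exists2 z, outside F z &
      [set hub F; z] \in B /\ [set mid F; z] \in B.
    case: (boolP ([set hub F; x] \in R)) => [/ans sub|eR].
      exists (mate F x); first by rewrite outside_mate.
      by split; apply: sub; rewrite answer_hub // !inE eqxx ?orbT.
    case: (boolP ([set mid F; x] \in R)) => [/ans sub|cR].
      exists (mate F x); first by rewrite outside_mate.
      by split; apply: sub; rewrite answer_mid // !inE eqxx ?orbT.
    exists x => //; split.
      by have := full _ _ (neq _ _ ie ox); rewrite (negPf eR).
    by have := full _ _ (neq _ _ ic ox); rewrite (negPf cR).
  exists (hub F |: (mid F |: [set z])).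
    apply: is_cliqueU1; first apply: is_cliqueU1.
    - by apply/cliqueP => p q; rewrite !inE => /eqP-> /eqP->; rewrite eqxx.
    - by move=> p; rewrite inE => /eqP->.
    - by move=> p; rewrite !inE => /orP[]/eqP->.
  rewrite !cardsU1 cards1 !inE negb_or hub_mid !neq //.
  by rewrite ltnS (leq_trans (subset_leq_card subS)) // cards2; case: (_ == _).
pose T := S :&: [set x | outside F x]; pose T' := mate F @: T.
have inT x : x \in T -> x \in S /\ outside F x by rewrite !inE => /andP.
have cardT' (U : {set 'I_n}) : #|mate F @: U| = #|U|.
  by rewrite card_imset //; apply: can_inj (mateK F).
have unpaired x y : x \in T -> y \in T -> y != mate F x.
  move=> /inT[xS ox] /inT[yS _]; apply: contraNneq no_pair => e.
  by apply/existsP; exists x; rewrite xS -e yS.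
have farT x y : x \in T -> y \in T -> x != y ->
    [set mate F x; mate F y] \in B /\ [set x; mate F y] \in B.
  move=> xT yT nxy; have [[xS ox] [yS oy]] := (inT x xT, inT y yT).
  exact: far ox oy nxy (unpaired _ _ xT yT) (clS _ _ xS yS nxy).
have clT' (U : {set 'I_n}) : U \subset T -> is_clique B (mate F @: U).
  move=> /subsetP UT; apply/cliqueP => _ _ /imsetP[x xU ->] /imsetP[y yU ->] nxy.
  have [] // := farT x y (UT x xU) (UT y yU).
  by apply: contraNneq nxy => ->.
have outT' (U : {set 'I_n}) y : U \subset T -> y \in mate F @: U -> outside F y.
  by move=> /subsetP UT /imsetP[x /UT/inT[_ ox] ->]; rewrite outside_mate.
have [/existsP[g /andP[gS ig]]|noG] := boolP [exists g in S, ~~ outside F g].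
  (* Special vertices are joined in blue, so a red clique has at most one of them. *)
  have eS : S = g |: T.
    apply/setP=> y; rewrite !inE; case: eqP => [-> //|/eqP nyg] /=.
    case: (boolP (outside F y)) => [_|iy]; first by rewrite andbT.
    rewrite andbF; apply/negP => yS.
    exact: notRB (clS _ _ yS gS nyg) (BG _ _ iy ig nyg).
  (* Any red edge gy has gy' and cy' among its answers, and ey' too if g = c. Hence both g and f are
     blue to all of T', a gain of two vertices against the single g. *)
  pose f := if g == mid F then hub F else mid F.
  have if_ : ~~ outside F f by rewrite /f; case: ifP.
  have nfg : f != g.
    by rewrite /f; case: (eqVneq g) => [->|]; rewrite ?hub_mid // eq_sym.
  have bg y : y \in T -> [set g; mate F y] \in B /\ [set f; mate F y] \in B.
    move=> yT; have [yS oy] := inT y yT.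
    have [b1 b2 b3] := near g y ig oy (clS _ _ gS yS (neq _ _ ig oy)).
    by split=> //; rewrite /f; case: eqP => [/b3|].
  exists (f |: (g |: T')).
    apply: is_cliqueU1; first apply: is_cliqueU1; first exact: clT'.
      by move=> _ /imsetP[y yT ->]; case: (bg y yT).
    move=> z; rewrite in_setU1 => /orP[/eqP->|/imsetP[y yT ->]].
      exact: BG.
    by case: (bg y yT).
  have nT w : ~~ outside F w -> w \notin T' by apply: contra; apply: outT'.
  have gT : g \notin T by apply: contra ig => /inT[].
  by rewrite eS !cardsU1 cardT' in_setU1 negb_or nfg gT !nT.
have eS : S = T.
  apply/setP => y; rewrite !inE; case: (boolP (y \in S)) => //= yS.
  by apply/esym; apply: contraNT noG => iy; apply/existsP; exists y; rewrite yS.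
rewrite eS.
(* Now S = T has the size of T', so one extra vertex suffices. *)
have win_with z : z \notin T' -> {in T, forall y, [set z; mate F y] \in B} ->
    exists2 S', is_clique B S' & #|T| < #|S'|.
  move=> zT' bz; exists (z |: T'); last by rewrite cardsU1 zT' cardT'.
  by apply: is_cliqueU1; [exact: clT' | move=> _ /imsetP[y yT ->]; apply: bz].
have TT' x : x \in T -> x \notin T'.
  move=> xT; apply/imsetP => -[y yT exy].
  by have := unpaired y x yT xT; rewrite exy eqxx.
(* For y in T other than x, the edge xy' is blue as an answer to xy. Only xx' is in doubt. *)
have [/existsP[x /andP[xT bx]]|all_red] :=
  boolP [exists x in T, [set x; mate F x] \in B].
  apply: (win_with x (TT' x xT)) => y yT.
  have [->//|nyx] := eqVneq y x.
  by case: (farT x y xT yT); rewrite // eq_sym.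
have redT x : x \in T -> [set x; mate F x] \in R.
  move=> xT; have [_ ox] := inT x xT.
  have nx : x != mate F x by rewrite eq_sym.
  have /orP[//|bx] := full _ _ nx.
  by case/negP: all_red; apply/existsP; exists x; rewrite xT.
have eT' (U : {set 'I_n}) : U \subset T -> hub F \notin mate F @: U.
  by move=> UT; apply: contra ie; apply: outT'.
(* The hub is the next candidate. It fails only if some ev' is red. *)
have [/existsP[v /andP[vT nbv]]|all_e] :=
    boolP [exists v in T, [set hub F; mate F v] \notin B]; last first.
  apply: (win_with (hub F) (eT' T (subxx _))) => y yT.
  apply: contraNT all_e => nb; apply/existsP; exists y.
  by rewrite yT.
have [vS ov] := inT v vT.
have ov' : outside F (mate F v) by rewrite outside_mate.
have eR : [set hub F; mate F v] \in R.
  by have := full _ _ (neq _ _ ie ov'); rewrite (negPf nbv) orbF.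
have bev : [set hub F; v] \in B.
  by apply: (ans _ _ eR); rewrite answer_hub // mateK inE eqxx.
(* Outside the exempt pair, the answers to the red edge ev' would include vv', which is red. *)
have exv : is_exempt F v.
  apply: contraT => nexv; case: (notRB _ (redT v vT)).
  apply: (ans _ _ eR); rewrite answer_hub // is_exempt_mate (negPf nexv) mateK.
  by rewrite (setUC [set v]) !inE eqxx !orbT.
have sv : T :\ v \subset T by apply: subD1set.
(* There is only one exempt pair and v lies in it, so the red edge yy' was answered by ey'. *)
have be y : y \in T :\ v -> [set hub F; mate F y] \in B.
  rewrite in_setD1 => /andP[nyv yT]; have [_ oy] := inT y yT.
  apply: (ans _ _ (redT y yT)); rewrite answer_mate // ifN ?inE ?eqxx ?orbT //.
  move: exv; rewrite /is_exempt => /orP[]/eqP ev.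
    by rewrite -ev (negPf nyv) (negPf (unpaired v y vT yT)).
  rewrite -ev (negPf nyv) orbF -(mateK F (exempt F)) -ev.
  exact: unpaired.
(* Replacing v' by v keeps the size of T', and ev is blue as an answer to ev'. *)
exists (hub F |: (v |: mate F @: (T :\ v))).
  apply: is_cliqueU1; first apply: is_cliqueU1; first exact: clT'.
    move=> _ /imsetP[y + ->]; rewrite in_setD1 => /andP[nyv yT].
    by case: (farT v y vT yT); rewrite // eq_sym.
  move=> z; rewrite in_setU1 => /orP[/eqP->//|/imsetP[y yT ->]].
  exact: be.
rewrite !cardsU1 in_setU1 negb_or (neq _ _ ie ov) (eT' _ sv) cardT'.
have -> : v \notin mate F @: (T :\ v).
  by apply: contra (TT' v vT); apply/subsetP/imsetS.
by rewrite (cardsD1 v T) vT.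
Qed.

(** * Completing the answers to a full turn *)

Lemma subset_between (T : finType) (K U : {set T}) m :
  K \subset U -> #|K| <= m <= #|U| ->
  exists t : {set T}, [/\ K \subset t, t \subset U & #|t| = m].
Proof.
move=> KU /andP[Km mU]; elim: m Km mU => [|m IH] Km mU.
  by exists K; split=> //; apply/eqP; rewrite -leqn0.
move: Km; rewrite leq_eqVlt => /predU1P[cK|Km]; first by exists K.
have [t [Kt tU ct]] := IH Km (ltnW mU).
have /properP[_ [x xU xt]] : t \proper U.
  by rewrite properEneq tU andbT; apply: contraTneq mU => <-; rewrite ct ltnn.
exists (x |: t); split.
- exact: subset_trans Kt (subsetUr _ _).
- by rewrite subUset sub1set xU.
- by rewrite cardsU1 xt ct.
Qed.

Lemma answerable_turn n (R B : edge_set n) a :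
  answerable R B a -> [disjoint a |: R & B] ->
  let U := complete_edges n :\: ((a |: R) :|: B) in
  exists t : edge_set n, [/\ t \subset U, #|t| == minn 3 #|U| & safe (a |: R) (B :|: t)].
Proof.
move=> [K [sK Kok] ansK] dis U.
(* Only the answers still uncoloured have to be played. The rest of the turn is arbitrary. *)
have [||t [Kt tU ct]] := @subset_between _ ([set z in K] :&: U) U (minn 3 #|U|).
- exact: subsetIr.
- rewrite geq_minr andbT leq_min subset_leq_card ?subsetIr // andbT.
  apply: leq_trans (subset_leq_card (subsetIl _ _)) _.
  by rewrite cardsE (leq_trans (card_size K)).
exists t; split=> //; first exact/eqP.
apply: ansK; first exact: subsetUl.
- move=> z zK; rewrite in_setU; case: (boolP (z \in B)) => //= zB.
  apply: (subsetP Kt); have /andP[zc zR] := Kok z zK.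
  by rewrite in_setI in_set zK in_setD zc in_setU negb_or zR zB.
- rewrite disjoints_subset; apply/subsetP => z zR.
  rewrite in_setC in_setU negb_or (disjointFr dis zR) /=.
  by apply: contraL zR => /(subsetP tU); rewrite in_setD in_setU negb_or => /andP[/andP[]].
Qed.

(** * The strategy along a play *)

Section Game.
Context (n : nat).
Implicit Types h : history n.

Lemma bigcup_rcons h (t : edge_set n) (P : pred nat) :
  \bigcup_(i < size (rcons h t) | P i) nth set0 (rcons h t) i =
  (if P (size h) then t else set0) :|: \bigcup_(i < size h | P i) nth set0 h i.
Proof.
rewrite size_rcons big_mkcond big_ord_recr /= nth_rcons ltnn eqxx setUC.
congr (_ :|: _); rewrite [RHS]big_mkcond; apply: eq_bigr => i _.
by rewrite nth_rcons /= ltn_ord.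
Qed.

Lemma red_rcons h t : red (rcons h t) = if odd (size h) then red h else t :|: red h.
Proof.
by rewrite /red (bigcup_rcons h t (fun i => ~~ odd i)); case: odd; rewrite ?set0U.
Qed.

Lemma blue_rcons h t :
  blue (rcons h t) = if odd (size h) then blue h :|: t else blue h.
Proof. by rewrite /blue bigcup_rcons setUC; case: odd; rewrite ?setU0. Qed.

Lemma take_rcons_le (T : Type) (s : seq T) x i : i <= size s -> take i (rcons s x) = take i s.
Proof. by move=> le; rewrite -cats1 takel_cat. Qed.

Lemma legal_history_rcons p q h t :
  legal_history p q (rcons h t) -> legal_history p q h /\ legal_turn p q h t.
Proof.
move=> leg; split=> [i ih|].
  have := leg i; rewrite size_rcons nth_rcons ih take_rcons_le ?(ltnW ih) //.
  by apply; apply: ltnW.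
have := leg (size h); rewrite size_rcons nth_rcons ltnn eqxx take_rcons_le //.
by rewrite take_size; apply.
Qed.

Lemma follows2_rcons (sigma : strategy n) h t : follows2 sigma (rcons h t) ->
  follows2 sigma h /\ (odd (size h) -> t = sigma h).
Proof.
move=> fol; split=> [i ih io|ho].
  have := fol i; rewrite size_rcons nth_rcons ih take_rcons_le ?(ltnW ih) //.
  by apply=> //; apply: ltnW.
have := fol (size h); rewrite size_rcons nth_rcons ltnn eqxx take_rcons_le //.
by rewrite take_size; apply.
Qed.

Definition safe_turn h (t : edge_set n) :=
  [/\ t \subset uncoloured h, #|t| == minn 3 #|uncoloured h|
    & safe (red h) (blue h :|: t)].

(** Safety quantifies over frames, so it is decided classically. No frame is remembered: a new one
    may serve at every turn. The default [set0] is returned only when no safe turn exists. *)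
Definition safe_strategy : strategy n :=
  fun h => odflt set0 [pick t | `[< safe_turn h t >]].

Lemma safe_strategyP h :
  (exists t, safe_turn h t) -> safe_turn h (safe_strategy h).
Proof.
move=> [t tP]; rewrite /safe_strategy; case: pickP => [t' /asboolP //|none].
by have := none t; rewrite asboolT.
Qed.

(** The empty history is set apart because safety requires blue edges. *)
Definition on_track h :=
  if odd (size h) then exists t, safe_turn h t
  else h = [::] \/ safe (red h) (blue h).

Lemma on_track_play h : 4 <= n -> legal_history 1 3 h -> follows2 safe_strategy h ->
  on_track h.
Proof.
move=> n4; elim/last_ind: h => [|h t IH]; first by left.
move=> /legal_history_rcons[leg /and3P[unfin tU ct]] /follows2_rcons[fol et].
have := IH leg fol; rewrite /on_track size_rcons /=.
move: ct; rewrite /player2_to_move; case: ifP => /= od ct.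
  move=> /safe_strategyP[_ _ sf]; right.
  by rewrite red_rcons blue_rcons od et.
(* As an edge is left, Alice's turn is exactly one edge. *)
have U0 : 0 < #|uncoloured h| by rewrite card_gt0.
move: ct; rewrite (minn_idPl U0) => /cards1P[a ea].
have aU : a \in uncoloured h by rewrite -sub1set -ea.
move: (aU); rewrite in_setD in_setU negb_or => /andP[/andP[aR aB] ac] track.
have ans_dis : answerable (red h) (blue h) a /\ [disjoint a |: red h & blue h].
  case: track => [e|sf].
    have [r0 b0] : red h = set0 /\ blue h = set0 by rewrite e /red /blue !big_ord0.
    rewrite r0 b0; split; first exact: opening_answerable.
    by rewrite disjoints_subset setC0 subsetT.
  split; first exact: safe_answerable.
  have [F [dis _ _ _ _]] := sf.
  by rewrite disjoints_subset subUset sub1set in_setC aB -disjoints_subset.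
have [t' t'P] := answerable_turn ans_dis.1 ans_dis.2.
by exists t'; rewrite /safe_turn /uncoloured red_rcons blue_rcons od ea.
Qed.

End Game.

Theorem theorem1p8 (n : nat) (hn : 4 <= n) : clique_game_won_by_player2 n 1 3.
Proof.
exists (@safe_strategy n) => h leg fol.
have := on_track_play hn leg fol; rewrite /on_track => track; split.
  rewrite /player2_to_move => unfin od; move: track; rewrite od => /safe_strategyP[tU ct _].
  by rewrite /legal_turn /player2_to_move unfin tU od.
move=> fin; have full : complete_edges n \subset red h :|: blue h.
  by rewrite -setD_eq0.
(* If Alice made the last move, the safe turn still promised to Bob is empty, so the position is
   already safe. The empty history is not finished, since the edge 01 is uncoloured. *)
have sf : safe (red h) (blue h).
  move: track; case: ifP => _ [] //.
    move=> t [tU _]; have -> : t = set0 by apply/eqP; rewrite -subset0 -(eqP fin).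
    by rewrite setU0.
  move=> e; move: full; rewrite e /red /blue !big_ord0 setU0 subset0.
  have [n0 n1] : 0 < n /\ 1 < n by split; apply: leq_trans hn.
  by move=> /eqP/setP/(_ [set Ordinal n0; Ordinal n1]); rewrite !inE cards2.
apply: safe_wins sf _ => x y nxy; rewrite -in_setU.
by apply: (subsetP full); rewrite inE cards2 nxy.
Qed.
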